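(* Let $G=(V,E,w)$ be any signed weighted graph with $V=[n]$, $n\ge 2$, without self-loops, with weight function $w:E\to\mathbb{R}$ (weights may be negative), and let $L=D-W$ be its graph Laplacian. Then $$\lambda_{\mathbf 1^\perp}(L)\;\ge\;\phi_G ,$$ where $\lambda_{\mathbf 1^\perp}(L)$ is the smallest eigenvalue of $L$ having an eigenvector orthogonal to $\mathbf 1$, equivalently $\lambda_{\mathbf 1^\perp}(L)=\min_{v\ne 0,\ v\perp \mathbf 1}\frac{v^\top L v}{v^\top v}$, and $\phi_G$ is the signed weighted edge expansion $$\phi_G=\frac12\, d^+_{\min}\,\min_{\emptyset\ne S\subset V,\ d^+(S)\le d^+(V)/2}\left(\frac{w^+(\partial S)}{d^+(S)}\right)^2+2\min_{\emptyset\neq S\subset V} w^-(\partial S).$$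
   Context: $W\in\mathbb{R}^{n\times n}$ is the (symmetric, zero-diagonal) weighted adjacency matrix of the undirected graph $G$: $W_{ij}=w(i,j)$ if $(i,j)\in E$ and $W_{ij}=0$ otherwise. $\mathbf 1$ is the all-ones vector. Define entrywise $W^+_{ij}=\max(W_{ij},0)$ and $W^-_{ij}=\min(W_{ij},0)$ (so $W^-_{ij}\le 0$). For $S\subset V$: $w^+(\partial S)=\sum_{i\in S,\,j\notin S}W^+_{ij}$ and $w^-(\partial S)=\sum_{i\in S,\,j\notin S}W^-_{ij}$. For a node $i$: $d^+(i)=\sum_{j\ne i}W^+_{ij}$ and $d(i)=\sum_{j\neq i}W_{ij}$ (the sum of the signed weights, not of their absolute values). For a set $S$: $d^+(S)=\sum_{i\in S}d^+(i)$. $d^+_{\min}=\min_{i\in V}d^+(i)$. $D=\mathrm{diag}(d(1),\dots,d(n))$ and $L=D-W$. Note $L\mathbf 1=0$. Convention: if $d^+_{\min}=0$, the first term of $\phi_G$ is taken to be $0$ (this is the only case in which a denominator $d^+(S)$ with $S\neq\emptyset$ can vanish). *)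

(* Defs.v *)
From mathcomp Require Import all_boot all_order all_algebra.
From mathcomp Require Import reals.

Set Implicit Arguments.
Unset Strict Implicit.
Unset Printing Implicit Defensive.

Import Order.TTheory GRing.Theory Num.Theory.
Local Open Scope ring_scope.

(* The weight function lives on the edges only: the values of [weight] at
   non-adjacent pairs are irrelevant, see [adjacency]. *)
Record signed_graph (R : realType) (n : nat) := SignedGraph {
  edge : rel 'I_n;
  weight : 'I_n -> 'I_n -> R;
  edge_sym : forall i j, edge i j = edge j i;
  edge_irrefl : forall i, edge i i = false;
  weight_sym : forall i j, edge i j -> weight i j = weight j i
}.

(* Minimum of [F i] over the [i] satisfying [P]; the value 0 is returned only
   when no [i] satisfies [P]. *)
Definition min_over (R : realType) (I : finType) (P : pred I) (F : I -> R) : R :=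
  if [pick i | P i] is Some i0 then F [arg min_(i < i0 | P i) F i]%O else 0.

Definition is_smallest (R : realType) (A : R -> Prop) (m : R) : Prop :=
  A m /\ forall x, A x -> m <= x.

Section SignedGraph.
Variables (R : realType) (n : nat) (G : signed_graph R n).
Implicit Types (i j : 'I_n) (S : {set 'I_n}).

Definition adjacency : 'M[R]_n :=
  \matrix_(i, j) (if edge G i j then weight G i j else 0).

Definition adjacency_pos : 'M[R]_n := \matrix_(i, j) Num.max (adjacency i j) 0.
Definition adjacency_neg : 'M[R]_n := \matrix_(i, j) Num.min (adjacency i j) 0.

Definition cut_pos S : R := \sum_(i in S) \sum_(j in ~: S) adjacency_pos i j.
Definition cut_neg S : R := \sum_(i in S) \sum_(j in ~: S) adjacency_neg i j.

Definition degree i : R := \sum_(j | j != i) adjacency i j.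
Definition degree_pos i : R := \sum_(j | j != i) adjacency_pos i j.
Definition volume_pos S : R := \sum_(i in S) degree_pos i.
Definition min_degree_pos : R := min_over predT degree_pos.

Definition laplacian : 'M[R]_n := diag_mx (\row_i degree i) - adjacency.

(* If [min_degree_pos] is 0, then the first term is 0 by convention; otherwise
   [volume_pos S] is positive for every nonempty [S].  For n >= 2 both minima
   over sets range over nonempty families whenever they are used.  The whole
   vertex set is not excluded: its cut is empty, and it can satisfy the volume
   constraint only if [min_degree_pos] is 0. *)
Definition signed_expansion : R :=
  (if min_degree_pos == 0 then 0
   else 2^-1 * min_degree_pos *
        min_over (fun S => (S != set0) &&
                           (volume_pos S <= volume_pos [set: 'I_n] / 2))
                 (fun S => (cut_pos S / volume_pos S) ^+ 2))
  + 2 * min_over (fun S => S != set0) cut_neg.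

End SignedGraph.

Section OrthogonalToOnes.
Variables (R : realType) (n : nat) (L : 'M[R]_n).

Definition orth_ones (v : 'cV[R]_n) : Prop := v^T *m (const_mx 1 : 'cV[R]_n) = 0.

Definition eigenvalue_orth_ones (a : R) : Prop :=
  exists v : 'cV[R]_n, [/\ v != 0, orth_ones v & L *m v = a *: v].

Definition rayleigh_orth_ones (a : R) : Prop :=
  exists v : 'cV[R]_n, [/\ v != 0, orth_ones v &
    a = (v^T *m L *m v) 0 0 / (v^T *m v) 0 0].

End OrthogonalToOnes.

(* Main.v *)
(* Split [W = W+ + W-]; the form [v^T L v] splits accordingly.  Everything rests on
   one coarea inequality: a cut bound on the superlevel sets of [f >= 0] integrates
   to a bound on the total variation of [f].
   For [W+], this is Cheeger's inequality: shift [v] by a weighted median, so that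
   the supports of the positive and negative parts have at most half the volume, and
   apply the coarea inequality to the square of each part, then AM-GM; the shift can
   only increase [v^T v] since [v] has mean zero.
   For [W-], the coarea inequality for the squares of the two parts of [v] bounds the
   form by twice the extreme cut, because [(x - y)^2 <= 2 (|x+^2 - y+^2| + |x-^2 - y-^2|)].
   The minimum of the Rayleigh quotient is attained by compactness of the sphere. *)
Require Import Defs.
From mathcomp Require Import classical_sets topology normedtype derive.
From mathcomp Require Import all_boot all_order all_algebra.
From mathcomp Require Import reals.
From mathcomp Require Import ring lra.

Set Implicit Arguments.
Unset Strict Implicit.
Unset Printing Implicit Defensive.

Import Order.TTheory GRing.Theory Num.Theory.
Import numFieldNormedType.Exports.
Local Open Scope ring_scope.

(** * The coarea inequality *)

(** The cut hypothesis ranges over all nonempty subsets of the support of [f], not just its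
    superlevel sets, so it passes to any function with smaller support and the induction goes
    through. [K] may have either sign, so both [W+] and [W-] are covered. *)
Lemma coarea_ge (R : realDomainType) (I : finType) (K : I -> I -> R)
    (g f : I -> R) :
    (forall i, 0 <= f i) ->
    (forall S : {set I}, S != set0 -> {in S, forall i, 0 < f i} ->
       \sum_(i in S) g i <= \sum_(i in S) \sum_(j in ~: S) K i j) ->
  \sum_i g i * f i <= \sum_i \sum_j K i j * Num.max (f i - f j) 0.
Proof.
(* Peel off the support of [f], weighted by the least positive value of [f] *)
have [m] := ubnP #|[set i | 0 < f i]|; elim: m f => // m IH f.
set S := [set i | 0 < f i]; rewrite ltnS => leSm f_ge0 gK.
have memS i : (i \in S) = (0 < f i) by rewrite inE.
have f_out i : i \notin S -> f i = 0.
  by rewrite memS -leNgt => fi_le0; apply/le_anti; rewrite fi_le0 f_ge0.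
have [S0|[i1 i1S]] := set_0Vmem S.
  have f0 i : f i = 0 by rewrite f_out // S0 inE.
  rewrite !big1 // => i _; rewrite ?f0 ?mulr0 // big1 // => j _.
  by rewrite !f0 subrr maxxx mulr0.
have [i0 i0S f_min] := arg_minP f i1S; set c := f i0 in f_min.
have c_gt0 : 0 < c by rewrite -memS.
pose f' i := f i - c * (i \in S)%:R.
have f'S i : i \in S -> f' i = f i - c by rewrite /f' => ->; rewrite mulr1.
have f'N i : i \notin S -> f' i = 0.
  by move=> iS; rewrite /f' (negPf iS) mulr0 subr0 f_out.
have f'_ge0 i : 0 <= f' i.
  have [iS|/f'N -> //] := boolP (i \in S).
  by rewrite f'S // subr_ge0 f_min.
have supp' i : 0 < f' i -> i \in S.
  by case: (boolP (i \in S)) => // iS; rewrite f'N // ltxx.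
have {}IH : \sum_i g i * f' i <= \sum_i \sum_j K i j * Num.max (f' i - f' j) 0.
  apply: IH => // [|U U0 Uf']; last first.
    by apply: gK => // i /Uf' /supp'; rewrite memS.
  apply: leq_trans leSm; apply/proper_card/properP; split.
    by apply/subsetP => i; rewrite inE => /supp'.
  by exists i0 => //; rewrite inE f'S // subrr ltxx.
have -> : \sum_i g i * f i = \sum_i g i * f' i + c * \sum_(i in S) g i.
  rewrite mulr_sumr [X in _ + X]big_mkcond -big_split /=; apply: eq_bigr => i _.
  by rewrite /f'; case: (i \in S) => /=; ring.
(* Only the pairs from [S] to its complement change, each losing exactly [c]: differences inside [S]
   are the same for [f] and [f'], and rows outside [S] vanish for both. *)
have -> : \sum_i \sum_j K i j * Num.max (f i - f j) 0 =
    \sum_i \sum_j K i j * Num.max (f' i - f' j) 0 +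
    c * \sum_(i in S) \sum_(j in ~: S) K i j.
  rewrite mulr_sumr [X in _ + X]big_mkcond -big_split /=; apply: eq_bigr => i _.
  case: (boolP (i \in S)) => iS; last first.
    rewrite addr0; apply: eq_bigr => j _; rewrite f'N // f_out // !sub0r.
    by rewrite !max_r ?oppr_le0.
  rewrite mulr_sumr [X in _ + X]big_mkcond -big_split /=; apply: eq_bigr => j _.
  rewrite inE; case: (boolP (j \in S)) => jS /=.
    by rewrite !f'S // addr0; congr (_ * Num.max _ _); ring.
  rewrite (f'N j) // (f_out j) // !subr0 !max_l ?f'_ge0 //.
  by rewrite f'S //; ring.
apply: lerD => //; apply: ler_wpM2l; first exact: ltW.
by apply: gK => [|i]; [apply/set0Pn; exists i1 | rewrite memS].
Qed.

(** The absolute value is the sum of the two one-sided truncations, which contribute equally when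
    [K] is symmetric; hence the factor 2. *)
Lemma coarea_sym_ge (R : realDomainType) (I : finType) (K : I -> I -> R)
    (g f : I -> R) :
    (forall i j, K i j = K j i) -> (forall i, 0 <= f i) ->
    (forall S : {set I}, S != set0 -> {in S, forall i, 0 < f i} ->
       \sum_(i in S) g i <= \sum_(i in S) \sum_(j in ~: S) K i j) ->
  (\sum_i g i * f i) *+ 2 <= \sum_i \sum_j K i j * `|f i - f j|.
Proof.
move=> symK f_ge0 /(coarea_ge f_ge0) le_gK.
suff -> : \sum_i \sum_j K i j * `|f i - f j| =
    (\sum_i \sum_j K i j * Num.max (f i - f j) 0) *+ 2 by rewrite lerMn2r.
rewrite mulr2n [X in _ = _ + X]exchange_big -big_split /=; apply: eq_bigr => i _.
rewrite -big_split /=; apply: eq_bigr => j _; rewrite (symK j i) -mulrDr.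
congr (_ * _).
by case: (lerP (f i) (f j)) => lefij;
  case: (lerP (f i - f j) 0) => ?; case: (lerP (f j - f i) 0) => ?; lra.
Qed.

(** * Sign splitting and the extreme-cut bound for nonpositive weights *)

Lemma pos_neg_parts_sq (R : realDomainType) (x : R) :
  x ^+ 2 = Num.max x 0 ^+ 2 + Num.max (- x) 0 ^+ 2.
Proof.
by case: (lerP x 0) => ?; case: (lerP (- x) 0) => ?; try (exfalso; lra);
  [have -> : x = 0 by lra|..]; ring.
Qed.

(** For equal signs, [|x - y| <= |x + y|] gives the bound even without the factor 2. For opposite
    signs the right side is [2 (x^2 + y^2)], with equality at [y = - x]. *)
Lemma sqr_sub_le_parts (R : realDomainType) (x y : R) :
  (x - y) ^+ 2 <=
    (`|Num.max x 0 ^+ 2 - Num.max y 0 ^+ 2| +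
     `|Num.max (- x) 0 ^+ 2 - Num.max (- y) 0 ^+ 2|) *+ 2.
Proof.
have same_sign (a b : R) : 0 <= a -> 0 <= b ->
    (a - b) ^+ 2 <= `|a ^+ 2 - b ^+ 2| *+ 2.
  wlog leba : a b / b <= a => [th a0 b0|a0 b0].
    have [/th-> //|/ltW/th th'] := lerP b a.
    by rewrite distrC -sqrrN opprB th'.
  rewrite ger0_norm; last by rewrite subr_ge0 lerXn2r.
  have -> : (a ^+ 2 - b ^+ 2) *+ 2 = (a - b) ^+ 2 + (a - b) * (a + b *+ 3) by ring.
  by rewrite lerDl mulr_ge0 ?subr_ge0 // addr_ge0 // mulrn_wge0.
have opp_sign (a b : R) : (a - b) ^+ 2 <= (a ^+ 2 + b ^+ 2) *+ 2.
  have -> : (a ^+ 2 + b ^+ 2) *+ 2 = (a - b) ^+ 2 + (a + b) ^+ 2 by ring.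
  by rewrite lerDl sqr_ge0.
have maxs (a : R) : (0 <= a /\ Num.max a 0 = a /\ Num.max (- a) 0 = 0) \/
    (a <= 0 /\ Num.max a 0 = 0 /\ Num.max (- a) 0 = - a).
  have [a0|/ltW a0] := lerP 0 a; [left|right].
    by rewrite max_r // oppr_le0.
  by rewrite max_l // oppr_ge0.
case: (maxs x) => -[x0 [-> ->]]; case: (maxs y) => -[y0 [-> ->]];
  rewrite ?expr0n /= ?subrr ?normr0 ?addr0 ?add0r ?subr0 ?sub0r ?normrN.
- exact: same_sign.
- by rewrite sqrrN !ger0_norm ?sqr_ge0 //; apply: opp_sign.
- by rewrite sqrrN !ger0_norm ?sqr_ge0 // [y ^+ 2 + _]addrC; apply: opp_sign.
- have := @same_sign (- x) (- y); rewrite !oppr_ge0 => /(_ x0 y0).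
  by rewrite -opprD sqrrN.
Qed.

(** The factor 4 is a 2 from the symmetric coarea inequality times a 2 from [sqr_sub_le_parts],
    whose direction is reversed by [K <= 0]. *)
Lemma max_cut_bound (R : realDomainType) (I : finType) (K : I -> I -> R)
    (m : R) (v : I -> R) :
    (forall i j, K i j = K j i) -> (forall i j, K i j <= 0) ->
    (forall S : {set I}, S != set0 ->
       m <= \sum_(i in S) \sum_(j in ~: S) K i j) ->
  (m * \sum_i v i ^+ 2) *+ 4 <= \sum_i \sum_j K i j * (v i - v j) ^+ 2.
Proof.
move=> symK K_le0 mK.
have coarea (f : I -> R) : (forall i, 0 <= f i) ->
    (m * \sum_i f i) *+ 2 <= \sum_i \sum_j K i j * `|f i - f j|.
  move=> f_ge0; rewrite mulr_sumr; apply: coarea_sym_ge => // S S0 _.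
  have cut_le0 : \sum_(i in S) \sum_(j in ~: S) K i j <= 0.
    by apply: sumr_le0 => i _; apply: sumr_le0.
  apply: le_trans (mK S S0); rewrite sumr_const.
  (* Coarea is used with the constant weight [m]: as [m <= 0], a nonempty [S] satisfies
     [m * #|S| <= m]. *)
  have m_le0 := le_trans (mK S S0) cut_le0.
  by rewrite -[leRHS]mulr1n; apply: ler_wnMn2l => //; rewrite card_gt0.
pose p i := Num.max (v i) 0 ^+ 2; pose q i := Num.max (- v i) 0 ^+ 2.
have -> : \sum_i v i ^+ 2 = \sum_i p i + \sum_i q i.
  by rewrite -big_split; apply: eq_bigr => i _; exact: pos_neg_parts_sq.
have /= := lerD (coarea p (fun i => sqr_ge0 _)) (coarea q (fun i => sqr_ge0 _)).
rewrite -mulrnDl -mulrDr -(ler_pMn2r (n := 2)) // -mulrnA => /le_trans; apply.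
rewrite -big_split -sumrMnl; apply: ler_sum => i _ /=.
rewrite -big_split -sumrMnl; apply: ler_sum => j _ /=.
rewrite -mulrDr -mulrnAr; apply: ler_wnM2l => //.
exact: sqr_sub_le_parts.
Qed.

(** * Cheeger's inequality for nonnegative weights *)

(** Local form: expansion is required only inside the support of [f], so that it can be applied to
    functions supported on at most half the volume. *)
Lemma cheeger (R : realFieldType) (I : finType) (K : I -> I -> R)
    (h : R) (f : I -> R) :
    (forall i j, K i j = K j i) -> (forall i j, 0 <= K i j) -> 0 <= h ->
    (forall i, 0 <= f i) ->
    (forall S : {set I}, S != set0 -> {in S, forall i, 0 < f i} ->
       h * \sum_(i in S) \sum_j K i j <= \sum_(i in S) \sum_(j in ~: S) K i j) ->
  h ^+ 2 * \sum_i (\sum_j K i j) * f i ^+ 2 <=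
    \sum_i \sum_j K i j * (f i - f j) ^+ 2.
Proof.
move=> symK K_ge0 h_ge0 f_ge0 hK.
set X := \sum_i (\sum_j K i j) * f i ^+ 2.
have coarea : (h * X) *+ 2 <= \sum_i \sum_j K i j * `|f i ^+ 2 - f j ^+ 2|.
  have -> : h * X = \sum_i (h * \sum_j K i j) * f i ^+ 2.
    by rewrite mulr_sumr; apply: eq_bigr => i _; rewrite mulrA.
  apply: coarea_sym_ge => // [i|S S0 Sf]; first exact: sqr_ge0.
  rewrite -mulr_sumr; apply: hK => // i /Sf fi2.
  by rewrite lt_def f_ge0 andbT; apply: contraTneq fi2 => ->; rewrite expr0n ltxx.
(* Multiplied by [h], [coarea] has [2 h^2 X] on its left; this bound absorbs one half and leaves
   [h^2 X]. *)
suff : h * (\sum_i \sum_j K i j * `|f i ^+ 2 - f j ^+ 2|) <=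
    \sum_i \sum_j K i j * (f i - f j) ^+ 2 + h ^+ 2 * X.
  by have := ler_wpM2l h_ge0 coarea; lra.
have -> : h ^+ 2 * X =
    \sum_i \sum_j K i j * (h ^+ 2 / 2 * (f i ^+ 2 + f j ^+ 2)).
  have XE : X = \sum_i \sum_j K i j * f i ^+ 2.
    by apply: eq_bigr => i _; rewrite mulr_suml.
  have XE' : X = \sum_i \sum_j K i j * f j ^+ 2.
    rewrite XE exchange_big; apply: eq_bigr => i _; apply: eq_bigr => j _.
    by rewrite symK.
  transitivity (h ^+ 2 / 2 * (X + X)); first by field.
  rewrite {1}XE XE' -big_split mulr_sumr; apply: eq_bigr => i _.
  rewrite -big_split mulr_sumr; apply: eq_bigr => j _ /=; ring.
rewrite mulr_sumr -big_split; apply: ler_sum => i _ /=.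
rewrite mulr_sumr -big_split; apply: ler_sum => j _ /=.
rewrite mulrCA -mulrDr; apply: ler_wpM2l => //.
(* AM-GM: [h |x - y| (x + y) <= (x - y)^2 + (h (x + y) / 2)^2] *)
rewrite subr_sqr normrM (ger0_norm (addr_ge0 (f_ge0 i) (f_ge0 j))).
rewrite -[(f i - f j) ^+ 2]real_normK ?num_real //; set y := `|_|.
have := sqr_ge0 (y - h * (f i + f j) / 2).
have := sqr_ge0 (h * (f i - f j)).
lra.
Qed.

(** The median is the least value [v im] with at most half the weight above it. The next smaller
    value [v k], if any, has more than half above it, which leaves less than half below [v im]. *)
Lemma weighted_median (R : realFieldType) (I : finType) (d v : I -> R) :
    (forall i, 0 <= d i) ->
  exists c, \sum_(i | c < v i) d i <= (\sum_i d i) / 2 /\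
            \sum_(i | v i < c) d i <= (\sum_i d i) / 2.
Proof.
move=> d_ge0; set T := \sum_i d i.
have T2_ge0 : 0 <= T / 2 by rewrite divr_ge0 // sumr_ge0.
have [i0 _|I0] := pickP (@predT I); last first.
  by exists 0; rewrite !big_pred0 // => i; have := I0 i.
pose P i := \sum_(j | v i < v j) d j <= T / 2.
have [iM _ v_max] := @arg_maxP _ _ _ i0 predT v isT.
have PM : P iM.
  by rewrite /P big_pred0 // => j; apply/negbTE; rewrite -leNgt; exact: v_max.
have [im Pm v_min] := @arg_minP _ _ _ iM P v PM.
exists (v im); split=> //.
have [i1 i1m|none] := pickP (fun i => v i < v im); last by rewrite big_pred0.
have [k km v_maxk] := @arg_maxP _ _ _ i1 [pred i | v i < v im] v i1m.
have : ~~ P k by apply: contraL km => /v_min; rewrite -leNgt.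
rewrite /P -ltNge => big_above.
(* By maximality of [v k] no value lies strictly between [v k] and [v im], so [v i <= v k] and
   [v i < v im] say the same. *)
have : T = \sum_(j | v k < v j) d j + \sum_(i | v i < v im) d i.
  rewrite /T (bigID (fun j => v k < v j)) /=; congr (_ + _).
  apply: eq_bigl => i; rewrite -leNgt; apply/idP/idP => [/le_lt_trans|]; first exact.
  exact: v_maxk.
by move=> TE; lra.
Qed.

Lemma cheeger_orth (R : realFieldType) (I : finType) (K : I -> I -> R)
    (h m : R) (v : I -> R) :
    (forall i j, K i j = K j i) -> (forall i j, 0 <= K i j) ->
    0 <= h -> 0 <= m -> (forall i, m <= \sum_j K i j) -> \sum_i v i = 0 ->
    (forall S : {set I}, S != set0 ->
       \sum_(i in S) \sum_j K i j <= (\sum_i \sum_j K i j) / 2 ->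
       h * \sum_(i in S) \sum_j K i j <= \sum_(i in S) \sum_(j in ~: S) K i j) ->
  h ^+ 2 * m * \sum_i v i ^+ 2 <= \sum_i \sum_j K i j * (v i - v j) ^+ 2.
Proof.
move=> symK K_ge0 h_ge0 m_ge0 m_le v0 hK.
pose d i := \sum_j K i j.
have d_ge0 i : 0 <= d i by apply: sumr_ge0.
have [c [above below]] := weighted_median v d_ge0.
pose u i := v i - c.
have part (f : I -> R) : (forall i, 0 <= f i) ->
    \sum_(i | 0 < f i) d i <= (\sum_i d i) / 2 ->
    h ^+ 2 * \sum_i d i * f i ^+ 2 <= \sum_i \sum_j K i j * (f i - f j) ^+ 2.
  move=> f_ge0 small; apply: cheeger => // S S0 Sf; apply: hK => //.
  (* A subset of the support has no more volume than the support itself. *)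
  apply: le_trans small; rewrite (bigID (mem S) (fun i => 0 < f i)) /=.
  rewrite [X in _ <= X + _](eq_bigl (mem S)); last first.
    by move=> i /=; case: (boolP (i \in S)) => [/Sf ->|]; rewrite ?andbF.
  by rewrite lerDl sumr_ge0.
pose p i := Num.max (u i) 0; pose q i := Num.max (- u i) 0.
have p_ge0 i : 0 <= p i by rewrite le_max lexx orbT.
have q_ge0 i : 0 <= q i by rewrite le_max lexx orbT.
have p_small : \sum_(i | 0 < p i) d i <= (\sum_i d i) / 2.
  by under eq_bigl do rewrite lt_max ltxx orbF subr_gt0.
have q_small : \sum_(i | 0 < q i) d i <= (\sum_i d i) / 2.
  by under eq_bigl do rewrite lt_max ltxx orbF oppr_gt0 subr_lt0.
have pq_le := lerD (part p p_ge0 p_small) (part q q_ge0 q_small).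
have : \sum_i \sum_j K i j * (p i - p j) ^+ 2 +
    \sum_i \sum_j K i j * (q i - q j) ^+ 2 <=
    \sum_i \sum_j K i j * (v i - v j) ^+ 2.
  rewrite -big_split; apply: ler_sum => i _ /=.
  rewrite -big_split; apply: ler_sum => j _ /=.
  rewrite -mulrDr; apply: ler_wpM2l => //.
  have -> : v i - v j = u i - u j by rewrite /u; ring.
  have pqE k : u k = p k - q k.
    by rewrite /p /q; case: (lerP (u k) 0) => ?; case: (lerP (- u k) 0) => ?; lra.
  have pq0 k : p k * q k = 0.
    rewrite /p /q; case: (lerP (u k) 0) => ?; case: (lerP (- u k) 0) => ?;
    rewrite ?mul0r ?mulr0 //; exfalso; lra.
  (* Since [p q = 0] at each vertex, the two sides differ by [2 (p i * q j + p j * q i)]. *)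
  have : 0 <= p i * q j by rewrite mulr_ge0.
  have : 0 <= p j * q i by rewrite mulr_ge0.
  have := pq0 i; have := pq0 j.
  rewrite !pqE; nra.
apply: le_trans; apply: le_trans pq_le.
rewrite -mulrDr -mulrA; apply: ler_wpM2l; first exact: sqr_ge0.
rewrite -big_split /=.
under [leRHS]eq_bigr do rewrite -mulrDr -pos_neg_parts_sq.
have u_ge : \sum_i v i ^+ 2 <= \sum_i u i ^+ 2.
  have -> : \sum_i u i ^+ 2 =
      \sum_i v i ^+ 2 - c *+ 2 * \sum_i v i + \sum_(i : I) c ^+ 2.
    rewrite mulr_sumr -sumrB -big_split /=; apply: eq_bigr => i _.
    by rewrite /u; ring.
  by rewrite v0 mulr0 subr0 lerDl sumr_ge0 // => i _; apply: sqr_ge0.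
apply: le_trans (ler_wpM2l m_ge0 u_ge) _; rewrite mulr_sumr.
by apply: ler_sum => i _; apply: ler_wpM2r; [exact: sqr_ge0|exact: m_le].
Qed.

(** * The Laplacian form and its bound by the signed expansion *)

Section MinOver.
Variables (R : realType) (I : finType) (P : pred I) (F : I -> R).

Lemma min_over_le i : P i -> min_over P F <= F i.
Proof.
rewrite /min_over; case: pickP => [i0 Pi0|none] Pi; last by rewrite none in Pi.
by case: arg_minP => // j _; apply.
Qed.

Lemma min_over_ge0 : (forall i, P i -> 0 <= F i) -> 0 <= min_over P F.
Proof.
move=> F_ge0; rewrite /min_over; case: pickP => // i0 Pi0.
by case: arg_minP => // j /F_ge0.
Qed.

End MinOver.

Section LaplacianForm.
Variables (R : realType) (n : nat) (G : signed_graph R n).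

Lemma adjacency_sym i j : adjacency G i j = adjacency G j i.
Proof.
by rewrite !mxE edge_sym; case: ifP => // e; rewrite weight_sym // edge_sym.
Qed.

Lemma adjacency_diag i : adjacency G i i = 0.
Proof. by rewrite mxE edge_irrefl. Qed.

Lemma degreeE i : degree G i = \sum_j adjacency G i j.
Proof. by rewrite [RHS](bigD1 i) //= adjacency_diag add0r. Qed.

Lemma degree_posE i : degree_pos G i = \sum_j adjacency_pos G i j.
Proof. by rewrite [RHS](bigD1 i) //= mxE adjacency_diag maxxx add0r. Qed.

Lemma laplacianE i j :
  laplacian G i j = degree G i *+ (i == j) - adjacency G i j.
Proof. by rewrite !mxE. Qed.

Lemma laplacian_sym : (laplacian G)^T = laplacian G.
Proof.
apply/matrixP => i j; rewrite mxE !laplacianE adjacency_sym eq_sym.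
by case: eqP => // ->.
Qed.

Lemma laplacian_ones : laplacian G *m (const_mx 1 : 'cV_n) = 0.
Proof.
apply/matrixP => i j; rewrite !mxE.
under eq_bigr do rewrite laplacianE [const_mx _ _ _]mxE mulr1.
rewrite sumrB -degreeE (bigD1 i) //= eqxx big1 ?addr0 ?subrr // => k /negPf ki.
by rewrite eq_sym ki.
Qed.

(** The double sum runs over ordered pairs, so each edge is counted twice. *)
Lemma laplacian_form (v : 'cV[R]_n) :
  (v^T *m laplacian G *m v) 0 0 *+ 2 =
    \sum_i \sum_j adjacency G i j * (v i 0 - v j 0) ^+ 2.
Proof.
have -> : (v^T *m laplacian G *m v) 0 0 =
    \sum_i \sum_j adjacency G i j * (v i 0 * (v i 0 - v j 0)).
  rewrite -mulmxA mxE; apply: eq_bigr => i _; rewrite !mxE.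
  under eq_bigr do rewrite laplacianE mulrBl.
  rewrite sumrB (bigD1 i) //= eqxx big1 => [|k /negPf ki]; last first.
    by rewrite eq_sym ki mul0r.
  rewrite addr0 degreeE mulr_suml -sumrB mulr_sumr; apply: eq_bigr => j _.
  by ring.
rewrite mulr2n [X in _ + X]exchange_big -big_split; apply: eq_bigr => i _ /=.
rewrite -big_split; apply: eq_bigr => j _ /=.
by rewrite [adjacency G j i]adjacency_sym; ring.
Qed.

Lemma signed_expansion_le_form (v : 'cV[R]_n) : \sum_i v i 0 = 0 ->
  signed_expansion G * \sum_i v i 0 ^+ 2 <= (v^T *m laplacian G *m v) 0 0.
Proof.
move=> v0; rewrite -(ler_pMn2r (n := 2)) // laplacian_form.
have -> : \sum_i \sum_j adjacency G i j * (v i 0 - v j 0) ^+ 2 =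
    \sum_i \sum_j adjacency_pos G i j * (v i 0 - v j 0) ^+ 2 +
    \sum_i \sum_j adjacency_neg G i j * (v i 0 - v j 0) ^+ 2.
  rewrite -big_split; apply: eq_bigr => i _ /=.
  rewrite -big_split; apply: eq_bigr => j _ /=.
  by rewrite -mulrDl [adjacency_pos _ _ _]mxE [adjacency_neg _ _ _]mxE addr_max_min addr0.
set N := \sum_i v i 0 ^+ 2.
have pos_ge0 i j : 0 <= adjacency_pos G i j by rewrite mxE le_max lexx orbT.
have pos_sym i j : adjacency_pos G i j = adjacency_pos G j i.
  by rewrite [LHS]mxE [RHS]mxE adjacency_sym.
have neg_le0 i j : adjacency_neg G i j <= 0 by rewrite mxE ge_min lexx orbT.
have neg_sym i j : adjacency_neg G i j = adjacency_neg G j i.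
  by rewrite [LHS]mxE [RHS]mxE adjacency_sym.
rewrite mulrDl mulrnDl; apply: lerD; last first.
  have /(_ _) := max_cut_bound (m := min_over (fun S => S != set0) (cut_neg G))
    (fun i => v i 0) neg_sym neg_le0.
  set m := min_over _ _; have -> : (2 * m * N) *+ 2 = (m * N) *+ 4 by ring.
  by apply => S S0; apply: (min_over_le (cut_neg G)).
have form_ge0 : 0 <= \sum_i \sum_j adjacency_pos G i j * (v i 0 - v j 0) ^+ 2.
  by do 2![apply: sumr_ge0 => ? _]; rewrite mulr_ge0 ?sqr_ge0.
(* If the least positive degree is 0, the first term is 0 by convention and nonnegativity of the
   form suffices. Otherwise nonempty sets have positive volume and the quotients are genuine. *)
case: eqP => [_|/eqP dmin_neq0]; first by rewrite mul0r mul0rn.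
have deg_ge0 i : 0 <= degree_pos G i by rewrite degree_posE sumr_ge0.
have dmin_ge0 : 0 <= min_degree_pos G by apply: min_over_ge0.
have dmin_le i : min_degree_pos G <= degree_pos G i by apply: min_over_le.
have vol_ge0 S : 0 <= volume_pos G S by apply: sumr_ge0.
have vol_gt0 (S : {set 'I_n}) : S != set0 -> 0 < volume_pos G S.
  case/set0Pn => i iS; rewrite /volume_pos (bigD1 i) //= ltr_wpDr ?sumr_ge0 //.
  by apply: lt_le_trans (dmin_le i); rewrite lt_def dmin_neq0.
have cut_ge0 S : 0 <= cut_pos G S by do 2![apply: sumr_ge0 => ? _].
set m := min_over _ _.
have m_ge0 : 0 <= m by apply: min_over_ge0 => S _; apply: sqr_ge0.
(* The minimum [m] is over squared ratios, so Cheeger's constant is its square root; the doubled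
   form cancels the factor one half. *)
have -> : (2^-1 * min_degree_pos G * m * N) *+ 2 =
    Num.sqrt m ^+ 2 * min_degree_pos G * N by rewrite sqr_sqrtr //; field.
have volE (S : {set _}) : \sum_(i in S) \sum_j adjacency_pos G i j = volume_pos G S.
  by apply: eq_bigr => i _; rewrite degree_posE.
apply: cheeger_orth => // [|i|S S0]; first exact: sqrtr_ge0.
  by rewrite -degree_posE.
rewrite volE; under [X in X / 2]eq_bigr do rewrite -degree_posE.
move=> small; rewrite -ler_pdivlMr ?vol_gt0 // -/(cut_pos G S).
rewrite -[leRHS]ger0_norm ?divr_ge0 //.
rewrite -sqrtr_sqr; apply: ler_wsqrtr.
apply: (min_over_le (fun S : {set _} => (cut_pos G S / volume_pos G S) ^+ 2)).
rewrite S0 (le_trans small) //= ler_pM2r ?invr_gt0 //.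
by rewrite [leRHS](eq_bigl predT) // => i; rewrite inE.
Qed.
End LaplacianForm.

(** * Attaining the Rayleigh minimum, and eigenvectors from minimisers *)

Lemma continuous_quad_form (R : realType) (n : nat) (M : 'M[R]_n) :
  continuous (fun u : 'rV[R]_n => (u *m M *m u^T) 0 0).
Proof.
have -> : (fun u : 'rV[R]_n => (u *m M *m u^T) 0 0) =
    (fun u => \sum_j (\sum_i u 0 i * M i j) * u 0 j).
  apply/boolp.funext => u; rewrite mxE; apply: eq_bigr => j _.
  by rewrite mxE [u^T _ _]mxE.
apply: (@continuous_big R 'I_n +%R); first exact: add_continuous.
move=> j _ u; apply: continuousM; last exact: coord_continuous.
apply: (@continuous_big R 'I_n +%R) => [|i _ w]; first exact: add_continuous.
by apply: continuousM; [exact: coord_continuous|exact: cst_continuous].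
Qed.

Lemma dotE (R : realDomainType) (n : nat) (v : 'cV[R]_n) :
  (v^T *m v) 0 0 = \sum_i v i 0 ^+ 2.
Proof. by rewrite mxE; apply: eq_bigr => i _; rewrite mxE. Qed.

Lemma dot_gt0 (R : realDomainType) (n : nat) (v : 'cV[R]_n) :
  v != 0 -> 0 < (v^T *m v) 0 0.
Proof.
move=> v0; rewrite dotE lt_def sumr_ge0 => [|i _]; last exact: sqr_ge0.
rewrite andbT; apply: contra_neq v0 => /eqP.
rewrite psumr_eq0 => [/allP vi0|i _]; last exact: sqr_ge0.
apply/matrixP => i j; rewrite ord1 mxE; apply/eqP.
by have := vi0 i (mem_index_enum i); rewrite /= sqrf_eq0.
Qed.

Lemma orth_onesE (R : realType) (n : nat) (v : 'cV[R]_n) :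
  orth_ones v <-> \sum_i v i 0 = 0.
Proof.
have sumE : (v^T *m (const_mx 1 : 'cV_n)) 0 0 = \sum_i v i 0.
  by rewrite mxE; apply: eq_bigr => i _; rewrite !mxE mulr1.
split=> [v1|v1]; first by rewrite -sumE v1 mxE.
by apply/matrixP => i j; rewrite !ord1 sumE v1 mxE.
Qed.

Lemma rayleigh_attained (R : realType) (n : nat) (L : 'M[R]_n) :
  (2 <= n)%N -> exists lambda, is_smallest (rayleigh_orth_ones L) lambda.
Proof.
move=> n_ge2; pose q M (u : 'rV[R]_n) : R := (u *m M *m u^T) 0 0.
(* The form of the all-ones matrix is the square of the coordinate sum, so orthogonality to [1] is
   also a quadratic condition: [continuous_quad_form] serves both constraints and the objective. *)
pose A := [set u | q 1%:M u = 1 /\ q (const_mx 1) u = 0]%classic.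
have q1 u : q 1%:M u = \sum_i u 0 i ^+ 2.
  by rewrite /q mulmx1 -[u in u *m _]trmxK dotE; apply: eq_bigr => i _; rewrite mxE.
have qJ u : q (const_mx 1) u = (\sum_i u 0 i) ^+ 2.
  rewrite /q mxE; under eq_bigr => j _.
    rewrite mxE; under eq_bigr do rewrite mxE mulr1.
    rewrite mxE; over.
  by rewrite -mulr_sumr.
have scaled (v : 'cV[R]_n) : v != 0 -> orth_ones v ->
    A ((Num.sqrt ((v^T *m v) 0 0))^-1 *: v^T).
  move=> v0 /orth_onesE v1; have vv := dot_gt0 v0.
  set a := (Num.sqrt _)^-1; split; last first.
    rewrite qJ; under eq_bigr do rewrite !mxE.
    by rewrite -mulr_sumr v1 mulr0 expr0n.
  rewrite q1; under eq_bigr do rewrite !mxE exprMn.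
  by rewrite -mulr_sumr -dotE exprVn sqr_sqrtr ?ltW // mulVf // gt_eqF.
(* [A] is closed in the compact cube with sides [[-1, 1]], which contains every unit vector. *)
have compactA : compact A.
  apply: (@subclosed_compact _ _
      [set u : 'rV[R]_n | forall i, `[-1, 1]%classic (u ord0 i)]%classic).
  - apply: (@closedI _ (q 1%:M @^-1` [set 1]) (q (const_mx 1) @^-1` [set 0]))%classic;
      by apply: preimage_closed => [u _|];
      [exact: continuous_quad_form|exact: closed_eq].
  - exact: (@rV_compact R n (fun=> `[-1, 1]%classic) (fun=> @segment_compact _ _ _)).
  move=> u [+ _] i; rewrite q1 /= in_itv /= -ler_norml => u1.
  rewrite -(@ler_pXn2r _ 2) // ?nnegrE // expr1n real_normK ?num_real // -u1.
  by rewrite (bigD1 i) //= lerDl sumr_ge0 // => j _; apply: sqr_ge0.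
(* The difference of two basis vectors, normalised; it exists because [n >= 2]. *)
have A0 : (A !=set0)%classic.
  pose i0 : 'I_n := Ordinal (ltnW n_ge2); pose i1 : 'I_n := Ordinal n_ge2.
  pose v : 'cV[R]_n := delta_mx i0 0 - delta_mx i1 0.
  eexists; apply: (scaled v).
    apply/eqP => /matrixP /(_ i0 0); rewrite !mxE !eqxx subr0 => /eqP.
    by rewrite oner_eq0.
  apply/orth_onesE; under eq_bigr do rewrite !mxE !andbT.
  have sum1 k : \sum_(i < n) (i == k)%:R = 1 :> R.
    by rewrite (bigD1 k) //= eqxx big1 ?addr0 // => i /negPf ->.
  by rewrite sumrB !sum1 subrr.
have [|u /set_mem uA u_min] := @compact_EVT_min _ R (q L) A A0 compactA.
  by apply: continuous_subspaceT; exact: continuous_quad_form.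
have rayl (v : 'cV[R]_n) : v != 0 ->
    (v^T *m L *m v) 0 0 / (v^T *m v) 0 0 =
    q L ((Num.sqrt ((v^T *m v) 0 0))^-1 *: v^T).
  move=> /dot_gt0 vv.
  set a := (Num.sqrt _)^-1; rewrite /q linearZ /= trmxK -!scalemxAl -scalemxAr.
  by rewrite ![fun_of_matrix (a *: _) _ _]mxE mulrA -expr2 exprVn sqr_sqrtr ?ltW // mulrC.
have [u1 uJ] := uA.
exists (q L u); split.
  exists u^T; split.
  - apply: contra_eq_neq u1 => /(congr1 trmx); rewrite trmxK trmx0 => ->.
    by rewrite /q !mul0mx mxE eq_sym oner_neq0.
  - apply/orth_onesE; under eq_bigr do rewrite mxE.
    by apply/eqP; rewrite -sqrf_eq0 -qJ uJ.
  - by rewrite trmxK; have := u1; rewrite /q mulmx1 => ->; rewrite divr1.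
move=> a [v [v0 v1 ->]]; rewrite rayl //; apply: u_min; apply: mem_set.
exact: scaled.
Qed.

(* The first-order condition says that [L v - a v] is orthogonal to the complement
   of [1]; it also lies in that complement because [L 1 = 0], so it vanishes. *)
Lemma rayleigh_min_eigenvalue (R : realType) (n : nat) (L : 'M[R]_n) (a : R) :
  L^T = L -> L *m (const_mx 1 : 'cV_n) = 0 ->
  is_smallest (rayleigh_orth_ones L) a ->
  is_smallest (eigenvalue_orth_ones L) a.
Proof.
move=> symL L1 [[v [v0 v1 aE]] a_min]; split=> [|b [w [w0 w1 Lw]]]; last first.
  apply: a_min; exists w; split=> //.
  by rewrite -mulmxA Lw -scalemxAr mxE mulfK // gt_eqF ?dot_gt0.
exists v; split=> //; apply/eqP; rewrite -subr_eq0; set r := _ - _.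
have form_ge (w : 'cV[R]_n) : orth_ones w ->
    a * (w^T *m w) 0 0 <= (w^T *m L *m w) 0 0.
  have [->|w0 w1] := eqVneq w 0; first by rewrite !mulmx0 mxE mulr0.
  by rewrite -ler_pdivlMr ?dot_gt0 //; apply: a_min; exists w.
have r1 : orth_ones r.
  rewrite /orth_ones /r linearB linearZ /= trmx_mul symL mulmxBl -mulmxA L1.
  by rewrite mulmx0 -scalemxAl v1 scaler0 subr0.
(* The bilinear form of [L - a]: nonnegative on the complement of [1], zero at the minimiser [v],
   and pairing [v] with the residual [r] to give the squared norm of [r]. *)
pose b (x y : 'cV[R]_n) := (x^T *m L *m y) 0 0 - a * (x^T *m y) 0 0.
have bDl x y z : b (x + y) z = b x z + b y z.
  by rewrite /b linearD /= !mulmxDl !mxE; ring.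
have bDr x y z : b z (x + y) = b z x + b z y.
  by rewrite /b !mulmxDr ![fun_of_matrix (_ + _) _ _]mxE; ring.
have bZl c x y : b (c *: x) y = c * b x y.
  by rewrite /b linearZ /= -!scalemxAl ![fun_of_matrix (_ *: _) _ _]mxE; ring.
have bZr c x y : b y (c *: x) = c * b y x.
  by rewrite /b -!scalemxAr ![fun_of_matrix (_ *: _) _ _]mxE; ring.
have bC x y : b x y = b y x.
  have tr11 (m : 'M[R]_1) : m 0 0 = m^T 0 0 by rewrite mxE.
  by rewrite /b tr11 [in X in _ - X]tr11 !trmx_mul symL !trmxK mulmxA.
have bv0 : b v v = 0.
  by rewrite /b aE divfK ?subrr // gt_eqF ?dot_gt0.
have brv : b r v = (r^T *m r) 0 0.
  by rewrite /b {3}/r mulmxBr -scalemxAr -mulmxA !mxE.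
clearbody r.
have b_ge t : 0 <= b (v - t *: r) (v - t *: r).
  rewrite /b subr_ge0; apply: form_ge.
  rewrite /orth_ones linearB linearZ /= mulmxBl -scalemxAl v1 r1.
  by rewrite scaler0 subr0.
have {}b_ge t : t * (r^T *m r) 0 0 *+ 2 <= t ^+ 2 * b r r.
  have := b_ge t; rewrite -scaleNr bDl !bDr !bZl !bZr bv0 (bC v r) brv.
  lra.
apply: contraT => /dot_gt0; set N := (_ *m _) 0 0 => N_gt0.
(* A nonzero [r] would violate [b_ge] at [t = 1] if [b r r <= 0], and otherwise at [t = N / b r r],
   the maximiser of [2 t N - t^2 b r r]. *)
have [b_le0|b_gt0] := lerP (b r r) 0.
  by have := b_ge 1; rewrite -/N; lra.
have := b_ge (N / b r r); rewrite -/N.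
have -> : (N / b r r) ^+ 2 * b r r = N / b r r * N by field; rewrite gt_eqF.
by rewrite mulr2n gerDl leNgt mulr_gt0 ?divr_gt0.
Qed.

Theorem theorem1 (R : realType) (n : nat) (hn : (2 <= n)%N)
    (G : signed_graph R n) :
  exists lambda : R,
    [/\ is_smallest (eigenvalue_orth_ones (laplacian G)) lambda,
        is_smallest (rayleigh_orth_ones (laplacian G)) lambda
      & signed_expansion G <= lambda].
Proof.
have [a a_min] := rayleigh_attained (laplacian G) hn.
exists a; split=> //.
  by apply: rayleigh_min_eigenvalue; [exact: laplacian_sym|exact: laplacian_ones|].
have [[v [v0 /orth_onesE v1 ->]] _] := a_min.
by rewrite ler_pdivlMr ?dot_gt0 // dotE signed_expansion_le_form.
Qed.
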